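(* Let $n\ge1$, let $\eta=\Phi_{\mathrm{FZ}}^{-1}\circ\xi\circ\Phi_{\mathrm{FZ}}:\mathfrak S_n\to\mathfrak S_n$, and let $\pi\in\mathfrak S_n$. Then, componentwise as equalities of (multi)sets, $$(\mathrm{Exc},\ \mathrm{Nexc},\ \mathrm{Ine}\sqcup\mathrm{Excb}\setminus\mathrm{Nexca},\ \mathrm{Ine},\ \mathrm{Edif}\setminus\mathrm{Exc}\setminus\mathrm{Ine})(\pi)=\kappa_{n+1}\circ(\mathrm{Nexc},\ \mathrm{Exc},\ \mathrm{Ine},\ \mathrm{Ine}\sqcup\mathrm{Excb}\setminus\mathrm{Nexca},\ \mathrm{Edif}\setminus\mathrm{Exc}\setminus\mathrm{Ine})(\eta(\pi)),$$ $$[n-1]\setminus\mathrm{Ep}(\pi)=\kappa_n(\mathrm{Ep}(\eta(\pi))).$$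
   Context: $[n]=\{1,\dots,n\}$; $\mathfrak S_n$ is the set of permutations of $[n]$, written $\pi=\pi(1)\cdots\pi(n)$. For multisets, $\sqcup$ adds multiplicities and $\setminus$ subtracts multiplicities, evaluated left to right. $\kappa_N(S)$ is the multiset obtained from $S$ by replacing each element $s$ (with multiplicity) by $N-s$; it is applied componentwise to tuples. Histories. A 2-Motzkin path of length $n$ is a word $w=w_1\cdots w_n$ over $\{\mathrm N,\mathrm S,\mathrm E,\mathrm{dE}\}$ such that, with $h_i:=\#\{j<i: w_j=\mathrm N\}-\#\{j<i: w_j=\mathrm S\}$ for $1\le i\le n+1$, one has $h_i\ge 0$ for all $i$ and $h_{n+1}=0$. An sr-Laguerre history of length $n$ is a triple $W=(w,h,c)$ where $w$ is a 2-Motzkin path of length $n$, $h=h_1\cdots h_n$ is its height sequence, and $c=c_1\cdots c_n$ is a sequence of integers with $0\le c_i\le h_i$ if $w_i\in\{\mathrm N,\mathrm E\}$ and $1\le c_i\le h_i$ if $w_i\in\{\mathrm S,\mathrm{dE}\}$. $\mathfrak L_n$ is the set of all of these; $\mathrm{cs}(W):=\max\{i\in[n]: c_i=0\}$. The map $\xi:\mathfrak L_n\to\mathfrak L_n$ is the unique involution such that for $W=(w,h,c)$ with $\mathrm{cs}(W)=m$ and $\xi(W)=(v,g,b)$: (1) $\mathrm{cs}(\xi(W))=n+1-m$; (2) for $j\ne n+1-m$, $v_j\in\{\mathrm N,\mathrm E\}$ iff $w_{n+1-j}\in\{\mathrm S,\mathrm{dE}\}$; (3) $g_j=h_{n+1-j}+1$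 if $j>n+1-m$ and $v_j\in\{\mathrm S,\mathrm{dE}\}$, $g_j=h_{n+1-j}-1$ if $j<n+1-m$ and $v_j\in\{\mathrm N,\mathrm E\}$, and $g_j=h_{n+1-j}$ otherwise; (4) $b_j=g_j-h_{n+1-j}+c_{n+1-j}$ for all $j\in[n]$. Permutation statistics. $\mathrm{Ep}(\pi)=\{i\in[n]:\pi(i)>i\}$; $\mathrm{Exc}(\pi)=\{\pi(i): 1\le i\le n,\ \pi(i)>i\}$; $\mathrm{Nexc}(\pi)=\{\pi(i): 1\le i\le n,\ \pi(i)\le i\}$; $\mathrm{Excb}(\pi)=\{\pi(i): \pi(i)<\pi(n),\ i\in\mathrm{Ep}(\pi)\}$; $\mathrm{Nexca}(\pi)=\{\pi(i): \pi(i)>\pi(n),\ i\notin\mathrm{Ep}(\pi)\}$. $\mathrm{Edif}(\pi)$ is the multiset union (adding multiplicities) over $i\in\mathrm{Ep}(\pi)$ of $\{i+1,\dots,\pi(i)\}$. Side numbers: if $i\in\mathrm{Ep}(\pi)$, $s_i=\#\{j\in\mathrm{Ep}(\pi): j<i,\ \pi(j)>\pi(i)\}$; if $i\notin\mathrm{Ep}(\pi)$, $s_i=\#\{j\notin\mathrm{Ep}(\pi): j>i,\ \pi(j)<\pi(i)\}$. $\mathrm{Ine}(\pi)$ is the multiset with $s_i$ copies of $\pi(i)$ for each $i\in[n]$. The bijection $\Phi_{\mathrm{FZ}}:\mathfrak S_n\to\mathfrak L_n$: $\Phi_{\mathrm{FZ}}(\pi)=(w,h,c)$ where $w_i=\mathrm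 N$ if $\pi^{-1}(i)>i<\pi(i)$; $w_i=\mathrm S$ if $\pi^{-1}(i)<i>\pi(i)$; $w_i=\mathrm E$ if $\pi^{-1}(i)\ge i\ge\pi(i)$; $w_i=\mathrm{dE}$ if $\pi^{-1}(i)<i<\pi(i)$; $h$ is the height sequence of $w$; and $c_i=s_{\pi^{-1}(i)}+\chi(w_i\in\{\mathrm S,\mathrm{dE}\})$, where $\chi$ is $1$ if the statement is true and $0$ otherwise.
   Formalization: In the first two components, Nexc(π) and Nexc(η(π)) are replaced by Nexc(π)∖{π(n)} and Nexc(η(π))∖{η(π)(n)}; as printed these two equations fail for every π (e.g. n=1: Exc=∅ but κ₂(Nexc)={1}). *)

(* Defs.v *)
From Stdlib Require Import ClassicalEpsilon.
From HB Require Import structures.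
From mathcomp Require Import all_boot all_order all_algebra all_fingroup.
From mathcomp Require Import finmap multiset zify.

Set Implicit Arguments.
Unset Strict Implicit.
Unset Printing Implicit Defensive.

Import Order.TTheory GRing.Theory Num.Theory.

Local Open Scope nat_scope.
Local Open Scope mset_scope.

(* Indices are 0-based: i : 'I_n stands for the element i.+1 of [n], so that
   every subset or multiset of labels below contains successors of ordinals.
   In particular the mirror image n + 1 - j of a position is rev_ord j. *)

(** * Laguerre histories *)

Inductive step := stepN | stepS | stepE | stepdE.

Definition step_eq (a b : step) :=
  match a, b with
  | stepN, stepN | stepS, stepS | stepE, stepE | stepdE, stepdE => true
  | _, _ => false
  end.

Lemma step_eqP : Equality.axiom step_eq.
Proof. by case=> -[]; constructor. Qed.

HB.instance Definition _ := hasDecEq.Build step step_eqP.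

Definition count_before n (s : step) (w : {ffun 'I_n -> step}) (i : nat) : nat :=
  #|[set j : 'I_n | (j < i) && (w j == s)]|.

(* height w i is h_{i+1} in 1-based notation: it only counts steps j < i, and
   height w n is the final height. *)
Definition height n (w : {ffun 'I_n -> step}) (i : nat) : int :=
  ((count_before stepN w i)%:Z - (count_before stepS w i)%:Z)%R.

Definition motzkin n (w : {ffun 'I_n -> step}) : bool :=
  [forall i : 'I_n.+1, (0 <= height w i)%R] && (height w n == 0%R).

(* The height sequence of a history is a function of its path, so a history is
   represented by the pair (w, c). *)
Definition laguerre n (W : {ffun 'I_n -> step} * {ffun 'I_n -> int}) : bool :=
  motzkin W.1 &&
  [forall i : 'I_n,
     (if W.1 i \in [:: stepN; stepE] then 0 <= W.2 i else 1 <= W.2 i)%R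
     && (W.2 i <= height W.1 i)%R].

Definition history n :=
  {W : {ffun 'I_n -> step} * {ffun 'I_n -> int} | laguerre W}.

Definition hw n (W : history n) : {ffun 'I_n -> step} := (val W).1.
Definition hh n (W : history n) (i : 'I_n) : int := height (hw W) i.
Definition hc n (W : history n) : {ffun 'I_n -> int} := (val W).2.

(* For n > 0 the maximum is over a nonempty set, as h_1 = 0 forces c_1 = 0. *)
Definition cs n (W : history n) : nat := \max_(i < n | hc W i == 0%R) i.+1.

Definition xi_rel n (W V : history n) : Prop :=
  let k := n.+1 - cs W in
  [/\ cs V = k,
      forall j : 'I_n, j.+1 != k ->
        (hw V j \in [:: stepN; stepE])
          = (hw W (rev_ord j) \in [:: stepS; stepdE]),
      forall j : 'I_n,
        hh V j =
          (if (k < j.+1)%N && (hw V j \in [:: stepS; stepdE])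
           then hh W (rev_ord j) + 1
           else if (j.+1 < k)%N && (hw V j \in [:: stepN; stepE])
           then hh W (rev_ord j) - 1
           else hh W (rev_ord j))%R
    & forall j : 'I_n,
        hc V j = (hh V j - hh W (rev_ord j) + hc W (rev_ord j))%R].

Definition xi_spec n (f : history n -> history n) : Prop :=
  involutive f /\ forall W, xi_rel W (f W).

(* The involution characterised by xi_spec, which exists and is unique for
   n > 0. *)
Definition xi n : history n -> history n := epsilon (inhabits id) (@xi_spec n).

(** * Permutation statistics *)

Section Statistics.
Variables (n : nat) (p : 'S_n).

Definition exced (i : 'I_n) : bool := i < p i.

(* p(n), read off as the last letter of the one-line word p(1)...p(n). *)
Definition last_value : nat := last 0 [seq (p i).+1 | i <- enum 'I_n].

Definition Ep : {fset nat} := [fset (nat_of_ord i).+1 | i : 'I_n & exced i]%fset.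
Definition Exc : {fset nat} := [fset (p i).+1 | i : 'I_n & exced i]%fset.
(* p(n) always belongs to Nexc p, and it is mirrored to the last value of
   eta p, which lies in Nexc (eta p) rather than in Exc (eta p): a symmetry
   exchanging Exc and Nexc has to leave the last value out of Nexc. *)
Definition Nexc : {fset nat} := [fset (p i).+1 | i : 'I_n & ~~ exced i]%fset.
Definition Excb : {fset nat} :=
  [fset (p i).+1 | i : 'I_n & exced i && ((p i).+1 < last_value)]%fset.
Definition Nexca : {fset nat} :=
  [fset (p i).+1 | i : 'I_n & ~~ exced i && (last_value < (p i).+1)]%fset.

(* In labels, the i-th block is {i.+2, ..., (p i).+1}. *)
Definition Edif : {mset nat} :=
  \big[msetD/mset0]_(i < n | exced i) seq_mset (index_iota i.+2 (p i).+2).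

Definition side (i : 'I_n) : nat :=
  if exced i then #|[set j : 'I_n | [&& exced j, j < i & p i < p j]]|
  else #|[set j : 'I_n | [&& ~~ exced j, i < j & p j < p i]]|.

Definition Ine : {mset nat} :=
  \big[msetD/mset0]_(i < n) msetn (side i) (p i).+1.

End Statistics.

Definition mset_of_fset (A : {fset nat}) : {mset nat} := seq_mset A.
Coercion mset_of_fset : finset_of >-> multiset_of.

(* Only applied to multisets of elements <= N, where N - s is not truncated. *)
Definition kappa (N : nat) (A : {mset nat}) : {mset nat} :=
  seq_mset [seq N - s | s <- A].

Definition interval1 (m : nat) : {fset nat} := [fset x in iota 1 m]%fset.

(** * The Foata-Zeilberger bijection *)

Definition FZ_step n (p : 'S_n) (i : 'I_n) : step :=
  let q := (p^-1)%g in
  if (i < q i) && (i < p i) then stepN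
  else if (q i < i) && (p i < i) then stepS
  else if (i <= q i) && (p i <= i) then stepE
  else stepdE.

Definition FZ_raw n (p : 'S_n) : {ffun 'I_n -> step} * {ffun 'I_n -> int} :=
  let w := [ffun i => FZ_step p i] in
  (w, [ffun i => ((side p ((p^-1)%g i))%:Z
                  + (w i \in [:: stepS; stepdE])%:Z)%R]).

(* The cut at k: both sides count the arcs i -> p i that cross k - 1/2. *)
Lemma card_cross n (p : 'S_n) (k : nat) :
  #|[set i : 'I_n | (i < k) && (k <= p i)]|
  = #|[set i : 'I_n | (k <= i) && (p i < k)]|.
Proof.
set A := [set i : 'I_n | i < k].
set B := [set i : 'I_n | p i < k].
have cAB : #|A| = #|B|.
  rewrite -(card_preimset A (@perm_inj _ p)).
  by apply: eq_card => i; rewrite !inE.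
have -> : [set i : 'I_n | (i < k) && (k <= p i)] = A :\: B.
  by apply/setP=> i; rewrite !inE -leqNgt andbC.
have -> : [set i : 'I_n | (k <= i) && (p i < k)] = B :\: A.
  by apply/setP=> i; rewrite !inE -leqNgt.
by rewrite !cardsD cAB setIC.
Qed.

Lemma FZ_stepN n (p : 'S_n) (j : 'I_n) :
  (FZ_step p j == stepN) = (j < (p^-1)%g j) && (j < p j).
Proof. by rewrite /FZ_step /=; do 3![case: ifP => //]. Qed.

Lemma FZ_stepS n (p : 'S_n) (j : 'I_n) :
  (FZ_step p j == stepS) = ((p^-1)%g j < j) && (p j < j).
Proof.
rewrite /FZ_step /=; case: ifP => [/andP[a _]|_]; first by case: ltngtP a.
by case: ifP => // _; case: ifP.
Qed.

Lemma perm_fix_inv n (p : 'S_n) (j : 'I_n) : ((p^-1)%g j == j) = (p j == j).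
Proof. by rewrite -(inj_eq (@perm_inj _ p)) permKV eq_sym. Qed.

Lemma FZ_stepSdE n (p : 'S_n) (j : 'I_n) :
  (FZ_step p j \in [:: stepS; stepdE]) = ((p^-1)%g j < j).
Proof.
have := perm_fix_inv p j; rewrite /FZ_step /= -!val_eqE /=.
by case: (ltngtP ((p^-1)%g j) j); case: (ltngtP (p j) j).
Qed.

Lemma height_FZ n (p : 'S_n) (k : nat) :
  height [ffun i => FZ_step p i] k
  = Posz #|[set i : 'I_n | (i < k) && (k <= p i)]|.
Proof.
rewrite /height /count_before.
set N := [set j : 'I_n | _ && _]; set S := [set j : 'I_n | _ && _].
set H := [set i : 'I_n | _ && _].
pose q := (p^-1)%g.
pose D := [set j : 'I_n | [&& j < k, q j < j & j < p j]].
have qp i : q (p i) = i by rewrite /q permK.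
have NE : N = [set j : 'I_n | [&& j < k, j < q j & j < p j]].
  by apply/setP=> j; rewrite !inE ffunE FZ_stepN.
have SE : S = [set j : 'I_n | [&& j < k, q j < j & p j < j]].
  by apply/setP=> j; rewrite !inE ffunE FZ_stepS.
have fixp (j : 'I_n) : (q j == j) = (p j == j).
  exact: perm_fix_inv.
have e1 : #|[set j : 'I_n | (j < k) && exced p j]| = #|N| + #|D|.
  rewrite -cardsUI (_ : N :&: D = set0) ?cards0 ?addn0.
    apply: eq_card => j; rewrite NE !inE /exced; move: (fixp j); rewrite -!val_eqE /=.
    by case: (j < k) => //=; case: (ltngtP (q j) j); case: (ltngtP (p j) j).
  by apply/setP=> j; rewrite NE !inE; case: (ltngtP (q j) j); rewrite ?andbF.
have e2 : #|[set j : 'I_n | (j < k) && (q j < j)]| = #|S| + #|D|.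
  rewrite -cardsUI (_ : S :&: D = set0) ?cards0 ?addn0.
    apply: eq_card => j; rewrite SE !inE; move: (fixp j); rewrite -!val_eqE /=.
    by case: (j < k) => //=; case: (ltngtP (q j) j); case: (ltngtP (p j) j).
  by apply/setP=> j; rewrite SE !inE; case: (ltngtP (p j) j); rewrite ?andbF.
have e3 : #|[set j : 'I_n | (j < k) && (q j < j)]|
          = #|[set i : 'I_n | (p i < k) && exced p i]|.
  rewrite -(card_preimset _ (@perm_inj _ p)).
  by apply: eq_card => i; rewrite !inE qp.
have e4 : #|[set j : 'I_n | (j < k) && exced p j]|
          = #|[set i : 'I_n | (p i < k) && exced p i]| + #|H|.
  rewrite -cardsUI (_ : _ :&: H = set0) ?cards0 ?addn0.
    apply: eq_card => i; rewrite !inE /exced.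
    by case: (ltnP (p i) k); case: (ltnP i k); case: (ltnP i (p i));
      rewrite ?andbF ?andbT ?orbF ?orbT //=; lia.
  by apply/setP=> i; rewrite !inE; case: (ltnP (p i) k); rewrite ?andbF.
lia.
Qed.

Lemma step_low (a : step) :
  (a \in [:: stepN; stepE]) = (a \notin [:: stepS; stepdE]).
Proof. by case: a. Qed.

Lemma FZ_laguerre n (p : 'S_n) : laguerre (FZ_raw p).
Proof.
apply/andP; split.
  apply/andP; split; first by apply/forallP=> i; rewrite /= height_FZ.
  rewrite /= height_FZ (_ : [set i | _] = set0) ?cards0 //.
  by apply/setP=> i; rewrite !inE (leqNgt n (p i)) !ltn_ord.
apply/forallP=> i; rewrite /= !ffunE height_FZ step_low FZ_stepSdE.
set j := (p^-1)%g i; have pj : p j = i by rewrite /j permKV.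
rewrite /side /exced pj; case: ltnP => [lt_ji|le_ij] /=; last first.
  rewrite card_cross; set A := [set _ | _]; set H := [set _ | _].
  suff : #|A| <= #|H| by rewrite addr0 lez_nat.
  apply/subset_leq_card/subsetP=> k; rewrite !inE => /and3P[_ jk ->].
  by rewrite andbT; lia.
set A := [set _ | _]; set H := [set _ | _].
have jH : j \in H by rewrite inE lt_ji pj /=.
have : #|A| <= #|H :\ j|.
  apply/subset_leq_card/subsetP=> k; rewrite !inE => /and3P[_ kj ik].
  by rewrite -val_eqE /=; lia.
by rewrite (cardsD1 j H) jH -PoszD !lez_nat addn1 add1n.
Qed.

Definition FZ n (p : 'S_n) : history n := exist _ (FZ_raw p) (FZ_laguerre p).

Definition FZ_inv n (W : history n) : 'S_n := odflt 1%g [pick p | FZ p == W].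

Definition eta n (p : 'S_n) : 'S_n := FZ_inv (xi (FZ p)).

(* Main.v *)
From Stdlib Require Import ClassicalEpsilon.
Require Import Defs.
From mathcomp Require Import all_boot all_order all_algebra all_fingroup.
From mathcomp Require Import finmap multiset zify.

(* Record a step of a path by two bits: pos (N or dE: under FZ, the index is an
   excedance position) and val (S or dE: the index is an excedance value), so
   that h_{i+1} = h_i + pos_i - val_i.  With m = cs W, the history V = xi W is
     val'_{n+1-i} = 1 - val_i for i <> m,   val'_{n+1-m} = 0 = val_m,
     g_{n+1-i} = h_i - val_i + [i < m],     b_{n+1-i} = c_i - val_i + [i < m],
   and comparing consecutive heights gives pos'_{n+1-i} = 1 - pos_{i-1}.  This
   description is symmetric in W and V.  If W = FZ p, then m is the last value
   of p, and the multiplicity of i in Exc, Ine, Edif is val_i, c_i - val_i, h_i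
   respectively, so each claim is an identity between the bits, heights and
   labels at i and at n+1-i. *)

Set Implicit Arguments.
Unset Strict Implicit.
Unset Printing Implicit Defensive.

Import Order.TTheory GRing.Theory Num.Theory.

Local Open Scope nat_scope.

(** * Steps as pairs of bits, and heights in terms of these bits *)

Definition exc_pos (s : step) : bool := s \in [:: stepN; stepdE].
Definition exc_val (s : step) : bool := s \in [:: stepS; stepdE].

Lemma card_below_succ n (P : pred 'I_n) (k : 'I_n) :
  #|[set j : 'I_n | (j < k.+1) && P j]| = #|[set j : 'I_n | (j < k) && P j]| + P k.
Proof.
rewrite (cardsD1 k) inE leqnn addnC; congr (_ + _).
by apply: eq_card => j; rewrite !inE -val_eqE /= ltnS; lia.
Qed.

(** A [stepdE] carries both bits, so it enters both cardinals and cancels in the difference. *)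
Lemma height_exc n (w : {ffun 'I_n -> step}) (k : nat) :
  height w k = (#|[set j : 'I_n | (j < k)%N && exc_pos (w j)]|%:Z
                - #|[set j : 'I_n | (j < k)%N && exc_val (w j)]|%:Z)%R.
Proof.
rewrite /height /count_before.
have split_dE (s : step) : s != stepdE ->
    #|[set j : 'I_n | (j < k) && (w j \in [:: s; stepdE])]|
    = #|[set j : 'I_n | (j < k) && (w j == s)]|
      + #|[set j : 'I_n | (j < k) && (w j == stepdE)]|.
  move=> sdE; rewrite -cardsUI (_ : _ :&: _ = set0) ?cards0 ?addn0.
    by apply: eq_card => j; rewrite !inE; case: (j < k).
  apply/setP=> j; rewrite !inE; case: (j < k) => //=.
  by case: eqVneq => // ->; apply: negbTE.
by rewrite !split_dE //; lia.
Qed.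

Lemma height0 n (w : {ffun 'I_n -> step}) : height w 0 = 0%R.
Proof. by rewrite height_exc !(eq_card0 (A := [set _ | _])) // => j; rewrite inE. Qed.

Lemma heightS n (w : {ffun 'I_n -> step}) (k : 'I_n) :
  height w k.+1 = (height w k + (exc_pos (w k))%:Z - (exc_val (w k))%:Z)%R.
Proof. by rewrite !height_exc !card_below_succ; lia. Qed.


(** * Placing values at positions with prescribed ranks *)

Lemma exists_least n (A : {set 'I_n}) : 0 < #|A| ->
  exists2 a, a \in A & forall b, b \in A -> a <= b.
Proof.
case/card_gt0P=> a0 a0A; case: (@arg_minnP _ a0 [in A] (@nat_of_ord n) a0A) => a aA amin.
by exists a.
Qed.

(** Removing the least element lowers the rank of every other element by one. *)
Lemma exists_rank n (A : {set 'I_n}) (t : nat) : t < #|A| ->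
  exists2 a, a \in A & #|[set b in A | b < a]| = t.
Proof.
elim: t A => [|t IH] A.
  case/exists_least=> a aA amin.
  exists a => //; apply/eqP; rewrite cards_eq0; apply/eqP/setP=> b; rewrite !inE.
  by case bA: (b \in A) => //=; rewrite ltnNge amin.
move=> tA; have /exists_least[a aA amin] : 0 < #|A| by lia.
have [|b] := IH (A :\ a); first by move: tA; rewrite (cardsD1 a A) aA.
rewrite !inE => /andP[ba bA] cb; exists b => //.
rewrite (cardsD1 a) inE aA ltn_neqAle amin // andbT val_eqE eq_sym ba add1n -cb.
by congr _.+1; apply: eq_card => c; rewrite !inE andbA.
Qed.

(* Read off the values of B in increasing order: each takes the free position
   whose rank is the prescribed number of larger values to its left. *)
Lemma exists_placement n (d : nat) (A B : {set 'I_n}) (s : 'I_n -> nat) :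
    #|A| = #|B| ->
    {in B, forall v : 'I_n, s v + #|[set u in B | u < v]| < #|[set a in A | a < v + d]|} ->
  exists f : 'I_n -> 'I_n,
    [/\ {in B, forall v : 'I_n, f v \in A}, {in B &, injective f},
        {in B, forall v : 'I_n, f v < v + d} &
        {in B, forall v : 'I_n, #|[set u in B | (v < u) && (f u < f v)]| = s v}].
Proof.
move eB: #|B| => b; elim: b => [|b IH] in A B eB *.
  move=> _ _; exists id; have /eqP := eB; rewrite cards_eq0 => /eqP->.
  by split=> v; rewrite inE.
move=> eA small; have /exists_least[v vB vmin] : 0 < #|B| by rewrite eB.
have sv := small v vB.
have [|a aA ca] := @exists_rank n A (s v).
  apply: leq_trans (leq_ltn_trans (leq_addr _ _) sv) _.
  by apply/subset_leq_card/subsetP=> x; rewrite inE => /andP[].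
(* Otherwise every element of [A] below [v + d] would precede [a], and there are more than [s v] of
   them. *)
have av : a < v + d.
  rewrite ltnNge; apply/negP=> va; move: sv; rewrite ltnNge => /negP; apply.
  rewrite -ca; apply: leq_trans (leq_addr _ _).
  apply/subset_leq_card/subsetP=> x; rewrite !inE => /andP[-> xv] /=; lia.
have eB' : #|B :\ v| = b by move: eB; rewrite (cardsD1 v) vB => -[].
have eA' : #|A :\ a| = b by move: eA; rewrite (cardsD1 a) aA => -[].
have vlt u : u \in B -> u != v -> v < u.
  by move=> uB uv; rewrite ltn_neqAle vmin // andbT eq_sym val_eqE.
(* The hypothesis survives the removal of [v] and [a]: for [u > v] both counts drop by one, since
   [a < v + d < u + d]. *)
have [|f [fA fI fd fs]] := IH _ _ eB' eA'.
  move=> u; rewrite !inE => /andP[uv uB]; have := small u uB; have vu := vlt u uB uv.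
  rewrite (cardsD1 v [set _ in B | _]) !inE vB vu (cardsD1 a [set _ in A | _]) !inE aA.
  have -> : (a < u + d) = true by lia.
  have -> : [set u0 in B | u0 < u] :\ v = [set u0 in B :\ v | u0 < u].
    by apply/setP=> x; rewrite !inE andbA.
  have -> : [set u0 in A | u0 < u + d] :\ a = [set u0 in A :\ a | u0 < u + d].
    by apply/setP=> x; rewrite !inE andbA.
  by lia.
(* All remaining positions get filled, by values larger than [v]; hence the larger values to the
   left of [a] are as many as the elements of [A] below [a]. *)
have fB : f @: (B :\ v) = A :\ a.
  apply/eqP; rewrite eqEcard card_in_imset // eA' eB' leqnn andbT.
  by apply/subsetP=> _ /imsetP[x xB ->]; exact: fA.
exists (fun u => if u == v then a else f u); split.
- by move=> u uB; case: eqVneq => // uv; have := fA u; rewrite !inE uv uB => /(_ isT)/andP[].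
- move=> u1 u2 u1B u2B /=.
  have fN u : u \in B -> u != v -> f u != a.
    by move=> uB uv; have := fA u; rewrite !inE uv uB => /(_ isT)/andP[].
  case: (eqVneq u1 v) => [->|u1v]; case: (eqVneq u2 v) => [->|u2v] //.
  + by move=> /esym/eqP; rewrite (negbTE (fN _ _ _)).
  + by move=> /eqP; rewrite (negbTE (fN _ _ _)).
  + by apply: fI; rewrite !inE ?u1v ?u2v.
- by move=> u uB; case: eqVneq => [->//|uv]; apply: fd; rewrite !inE uv.
move=> u uB; case: (eqVneq u v) => [->|uv].
  rewrite -ca -(@card_in_imset _ _ f).
    apply: eq_card => x; rewrite [RHS]inE; apply/imsetP/andP.
      case=> y; rewrite !inE => /and3P[yB vy]; case: eqVneq => [yv|yv ya ->].
        by rewrite yv ltnn in vy.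
      by have := fA y; rewrite !inE yv yB => /(_ isT)/andP[].
    case=> xA xa; have : x \in A :\ a.
      by rewrite !inE xA andbT; apply: contraTneq xa => ->; rewrite ltnn.
    rewrite -fB => /imsetP[y]; rewrite !inE => /andP[yv yB] xE.
    by exists y; rewrite // !inE (negbTE yv) yB vlt // -xE.
  move=> x y; rewrite !inE => /and3P[xB vx _] /and3P[yB vy _]; apply: fI;
    by rewrite !inE ?xB ?yB andbT -val_eqE /=; lia.
(* Adding the least value [v] changes no count of larger values. *)
rewrite -fs ?inE ?uv //; apply: eq_card => x; rewrite !inE.
by case: (eqVneq x v) => [->|xv] //=; rewrite ltnNge vmin ?andbF.
Qed.

(** * Surjectivity of the Foata-Zeilberger map *)

Lemma step_ext (s t : step) : exc_pos s = exc_pos t -> exc_val s = exc_val t -> s = t.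
Proof. by case: s; case: t. Qed.

Lemma exc_pos_FZ n (p : 'S_n) (i : 'I_n) : exc_pos (FZ_step p i) = exced p i.
Proof.
have := perm_fix_inv p i; rewrite /FZ_step /exced -!val_eqE /=.
by case: (ltngtP ((p^-1)%g i) i); case: (ltngtP (p i) i).
Qed.

Lemma exc_val_FZ n (p : 'S_n) (i : 'I_n) : exc_val (FZ_step p i) = ((p^-1)%g i < i).
Proof. exact: FZ_stepSdE. Qed.

Lemma hc_bounds n (W : history n) (i : 'I_n) :
  ((exc_val (hw W i))%:Z <= hc W i)%R /\ (hc W i <= hh W i)%R.
Proof.
have /andP[_ /forallP/(_ i)/andP[lo hi]] := valP W; split=> //.
by move: lo; rewrite step_low -/(exc_val _) /hw /hc; case: exc_val.
Qed.

Lemma exc_val_hc0 n (W : history n) (m : 'I_n) :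
  hc W m = 0%R -> exc_val (hw W m) = false.
Proof. by move=> cm; have [] := hc_bounds W m; rewrite cm; case: exc_val. Qed.

Lemma hh_end n (W : history n) : height (hw W) n = 0%R.
Proof. by have /andP[/andP[_ /eqP]] := valP W. Qed.

(** The first [k] positions are the mirror images of the last [k]. This turns counts on the reversed
    nonexceedances back into heights. *)
Lemma card_rev_below n (P : pred 'I_n) (k : nat) : k <= n ->
  #|[set u : 'I_n | (u < k) && ~~ P (rev_ord u)]| + #|[set j : 'I_n | P j]|
  = k + #|[set j : 'I_n | (j < n - k) && P j]|.
Proof.
elim: k => [|k IH] kn.
  rewrite subn0 eq_card0 => [|j]; last by rewrite inE.
  by congr (_ + _); apply: eq_card => j; rewrite !inE ltn_ord.
have := IH (ltnW kn); have ik : rev_ord (Ordinal kn) = n - k.+1 :> nat by [].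
rewrite (card_below_succ (fun u => ~~ P (rev_ord u)) (Ordinal kn)).
rewrite (_ : n - k = (rev_ord (Ordinal kn)).+1) ?card_below_succ ?ik /=; last by lia.
by case: (P _) => /=; lia.
Qed.

(** The inverse of [p] is assembled from two placements. Exceedance values go to exceedance
    positions with side number c - 1. The others are placed after reversing positions and values, so
    that smaller values to the right become larger values to the left. *)
Lemma FZ_surj n (W : history n) : exists p : 'S_n, FZ p = W.
Proof.
pose up i := exc_pos (hw W i); pose hi i := exc_val (hw W i).
have drop P : #|[set j : 'I_n | (j < n) && P j]| = #|[set j : 'I_n | P j]|.
  by apply: eq_card => j; rewrite !inE ltn_ord.
have eq_total : #|[set j | up j]| = #|[set j | hi j]|.
  have := hh_end W; rewrite height_exc => /eqP; rewrite subr_eq0 => /eqP[].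
  by rewrite !drop.
have belowE (P : pred 'I_n) k :
    #|[set u in [set j | P j] | u < k]| = #|[set j : 'I_n | (j < k) && P j]|.
  by apply: eq_card => j; rewrite !inE andbC.
have hhE i : (hh W i = #|[set j : 'I_n | (j < i)%N && up j]|%:Z
                     - #|[set j : 'I_n | (j < i)%N && hi j]|%:Z)%R.
  exact: height_exc.
(* Here d = 0 makes the position strictly smaller than the value; the counting hypothesis is c <=
   h. *)
have [v|f [fA fI fd fs]] := @exists_placement n 0 [set j | up j] [set j | hi j]
    (fun v => `|hc W v - 1|%N) eq_total.
  rewrite inE => hiv; have [] := hc_bounds W v; rewrite -/(hi v) hiv hhE addn0.
  rewrite !belowE /= => *; lia.
have eq_rev : #|[set j | ~~ up (rev_ord j)]| = #|[set j | ~~ hi (rev_ord j)]|.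
  have := card_rev_below up (leqnn n); have := card_rev_below hi (leqnn n).
  have drop0 P : #|[set j : 'I_n | (j < n - n) && P j]| = 0.
    by apply: eq_card0 => j; rewrite !inE subnn.
  by rewrite !drop !drop0 eq_total => <- /addIn.
(* Here d = 1, because a nonexceedance may be a fixed point; the hypothesis is again c <= h,
   rewritten by [card_rev_below]. *)
have [v|g [gA gI gd gs]] := @exists_placement n 1 [set j | ~~ up (rev_ord j)]
    [set j | ~~ hi (rev_ord j)] (fun v => `|hc W (rev_ord v)|%N) eq_rev.
  rewrite inE => hiv; have [] := hc_bounds W (rev_ord v).
  rewrite -/(hi _) (negbTE hiv) hhE.
  have lt_vn := ltn_ord v.
  have eup : #|[set u : 'I_n | (u < v.+1) && ~~ up (rev_ord u)]| + #|[set j | hi j]|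
             = v.+1 + #|[set j : 'I_n | (j < rev_ord v) && up j]|.
    by rewrite -eq_total (card_rev_below up).
  have ehi : #|[set u : 'I_n | (u < v) && ~~ hi (rev_ord u)]| + #|[set j | hi j]|
             = v + #|[set j : 'I_n | (j < rev_ord v) && hi j]|.
    rewrite (card_rev_below hi (ltnW lt_vn)) (_ : n - v = (rev_ord v).+1); last by rewrite /=; lia.
    by rewrite card_below_succ (negbTE hiv) addn0.
  by rewrite (belowE (fun u => ~~ up (rev_ord u))) (belowE (fun u => ~~ hi (rev_ord u))) addn1; lia.
(* [q v] is the position of the value [v]. The two cases have disjoint images by [up_q], whence
   injectivity. *)
pose q v := if hi v then f v else rev_ord (g (rev_ord v)).
have up_q v : up (q v) = hi v.
  rewrite /q; case: ifPn => hiv; first by have := fA v; rewrite !inE hiv => /(_ isT).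
  by apply: negbTE; have := gA (rev_ord v); rewrite !inE rev_ordK; apply.
have q_inj : injective q.
  move=> u v quv; have hiE : hi u = hi v by rewrite -!up_q quv.
  move: quv; rewrite /q hiE; case: ifPn => hiv; first by apply: fI; rewrite inE ?hiE.
  by move/rev_ord_inj/gI => /(_ _ _)/rev_ord_inj; apply; rewrite inE rev_ordK ?hiE.
have q_lt v : (q v < v) = hi v.
  rewrite /q; case: ifPn => hiv.
    by have := fd v; rewrite inE hiv => /(_ isT); rewrite addn0.
  have := gd (rev_ord v); rewrite inE rev_ordK hiv => /(_ isT) /=.
  by have := ltn_ord v; have := ltn_ord (g (rev_ord v)); lia.
pose p := ((perm q_inj)^-1)%g; exists p.
have pV i : (p^-1)%g i = q i by rewrite /p invgK permE.
have pq v : p (q v) = v by rewrite -pV permKV.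
have stepE i : FZ_step p i = hw W i.
  have iE : i = q (p i) by rewrite -pV permK.
  apply: step_ext; last by rewrite exc_val_FZ pV q_lt.
  by rewrite exc_pos_FZ -/(up i) /exced [in up i]iE up_q -q_lt -iE.
have card_q (Q : 'I_n -> 'I_n -> bool) :
    #|[set j | Q j (p j)]| = #|[set u | Q (q u) u]|.
  rewrite -(card_preimset _ q_inj); apply: eq_card => u.
  by rewrite !inE pq.
have exced_q u : exced p (q u) = hi u by rewrite /exced pq q_lt.
apply: val_inj; rewrite /= /FZ_raw [RHS]surjective_pairing; congr (_, _).
  by apply/ffunP=> i; rewrite ffunE stepE.
apply/ffunP=> v; rewrite -[RHS]/(hc W v) !ffunE stepE pV -/(exc_val _) -/(hi v).
rewrite /side exced_q pq; have [] := hc_bounds W v; rewrite -/(hi v).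
case: ifP => hiv c_ge _.
  rewrite (card_q (fun j u => [&& exced p j, j < q v & v < u])).
  have := fs v; rewrite inE hiv => /(_ isT).
  rewrite (eq_card (B := [set u | [&& exced p (q u), q u < q v & v < u]])) => [->|u]; first by lia.
  rewrite !inE exced_q; case hiu: (hi u) => //=.
  by rewrite /q hiu hiv andbC.
rewrite (card_q (fun j u => [&& ~~ exced p j, q v < j & u < v])).
have := gs (rev_ord v); rewrite inE rev_ordK hiv => /(_ isT).
rewrite -[X in X = _ -> _](card_preimset _ rev_ord_inj).
rewrite (eq_card (B := [set u | [&& ~~ exced p (q u), q v < q u & u < v]])) => [->|u]; first by lia.
rewrite !inE exced_q rev_ordK; case hiu: (hi u) => //=.
rewrite /q hiu hiv /=.
by have := ltn_ord v; have := ltn_ord u;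
  have := ltn_ord (g (rev_ord v)); have := ltn_ord (g (rev_ord u)); lia.
Qed.

(** * Existence of xi *)

Lemma cs_eq n (W : history n) (m : 'I_n) :
  hc W m = 0%R -> (forall i : 'I_n, m < i -> hc W i <> 0%R) -> cs W = m.+1.
Proof.
move=> cm c_gt; apply/eqP; rewrite eqn_leq; apply/andP; split.
  by apply/bigmax_leqP=> i /eqP ci; rewrite ltnS leqNgt; apply/negP=> /c_gt.
by apply: (leq_bigmax_cond (F := fun i : 'I_n => i.+1)); rewrite cm.
Qed.

(** The first height is 0, which forces the first label to be 0; the last zero label is the first
    one in reversed order. *)
Lemma csP n (W : history n) : 0 < n ->
  exists m : 'I_n, [/\ cs W = m.+1, hc W m = 0%R &
    forall i : 'I_n, m < i -> hc W i <> 0%R].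
Proof.
move=> n_gt0; pose A := [set i : 'I_n | hc W (rev_ord i) == 0%R].
have [] := @exists_least n A.
  apply/card_gt0P; exists (rev_ord (Ordinal n_gt0)); rewrite inE rev_ordK.
  by have [] := hc_bounds W (Ordinal n_gt0); rewrite /hh height0; lia.
move=> r; rewrite inE => /eqP cr rmin; exists (rev_ord r).
have c_gt (i : 'I_n) : rev_ord r < i -> hc W i <> 0%R.
  move=> ri ci; have := rmin (rev_ord i); rewrite inE rev_ordK ci => /(_ isT) /=.
  by move: ri => /=; have := ltn_ord i; have := ltn_ord r; lia.
by split=> //; apply: cs_eq.
Qed.

(* V is the history prescribed by conditions (1)-(4) on xi W, for cs W = m + 1;
   the first two clauses express cs W = m + 1. *)
Definition mirror n (W V : history n) (m : 'I_n) : Prop :=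
  [/\ hc W m = 0%R,
      forall i : 'I_n, m < i -> hc W i <> 0%R,
      forall i, exc_val (hw V (rev_ord i)) = (i != m) && ~~ exc_val (hw W i),
      forall i : 'I_n, (hh V (rev_ord i) = hh W i - (exc_val (hw W i))%:Z + (i < m)%N%:Z)%R
    & forall i : 'I_n, (hc V (rev_ord i) = hc W i - (exc_val (hw W i))%:Z + (i < m)%N%:Z)%R].

(** Heights and labels are shifted by [i < m] - val_i. For i other than m, reversal turns this into
    [m < i] - (1 - val_i), its opposite; at m both shifts vanish. *)
Lemma mirror_sym n (W V : history n) (m : 'I_n) :
  mirror W V m -> mirror V W (rev_ord m).
Proof.
move=> [cm c_gt valV hV cV]; have valm := exc_val_hc0 cm.
have [valE hE cE] : [/\ forall i, exc_val (hw V i)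
        = (rev_ord i != m) && ~~ exc_val (hw W (rev_ord i)),
      forall i : 'I_n, (hh V i = hh W (rev_ord i)
        - (exc_val (hw W (rev_ord i)))%:Z + (rev_ord i < m)%N%:Z)%R
    & forall i : 'I_n, (hc V i = hc W (rev_ord i)
        - (exc_val (hw W (rev_ord i)))%:Z + (rev_ord i < m)%N%:Z)%R].
  by split=> i; rewrite -?valV -?hV -?cV rev_ordK.
have revE (i : 'I_n) : (i == rev_ord m) = (rev_ord i == m).
  by rewrite -(inj_eq rev_ord_inj) rev_ordK.
have rev_lt (i : 'I_n) : (i < rev_ord m) = (m < rev_ord i).
  by have := ltn_ord i; have := ltn_ord m; rewrite /=; lia.
split.
- by rewrite cE rev_ordK cm valm ltnn.
(* To the left of [m] the new label is c - val + 1, which is positive because val <= c. *)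
- move=> i mi; rewrite cE; have [+ _] := hc_bounds W (rev_ord i).
  have -> : rev_ord i < m by move: mi; rewrite /=; have := ltn_ord i; lia.
  lia.
- by move=> i; rewrite valE revE; case: eqVneq => [->|_]; rewrite ?valm ?negbK.
- move=> i; rewrite hE valE rev_lt.
  case: eqVneq => [->|ne]; rewrite ?valm ?ltnn /=; first by lia.
  case: (ltngtP (rev_ord i) m) => [h|h|/val_inj h]; last by rewrite h eqxx in ne.
    by case: exc_val => /=; lia.
  by case: exc_val => /=; lia.
- move=> i; rewrite cE valE rev_lt.
  case: eqVneq => [->|ne]; rewrite ?valm ?ltnn /=; first by lia.
  case: (ltngtP (rev_ord i) m) => [h|h|/val_inj h]; last by rewrite h eqxx in ne.
    by case: exc_val => /=; lia.
  by case: exc_val => /=; lia.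
Qed.

(** Consecutive heights and the value bit determine the position bit; for the last step, the final
    height 0 serves. *)
Lemma history_ext n (W V : history n) :
    (forall i, exc_val (hw W i) = exc_val (hw V i)) ->
    (forall i, hh W i = hh V i) -> (forall i, hc W i = hc V i) ->
  W = V.
Proof.
move=> valE hE cE; have heightE k : k <= n -> height (hw W) k = height (hw V) k.
  rewrite leq_eqVlt => /predU1P[->|kn]; first by rewrite !hh_end.
  exact: hE (Ordinal kn).
apply: val_inj; rewrite [LHS]surjective_pairing [RHS]surjective_pairing.
congr (_, _); apply/ffunP=> i; last exact: cE.
apply: step_ext; last exact: valE.
have := heightE i.+1 (ltn_ord i); rewrite !heightS heightE 1?ltnW // valE -/(hw _).
by rewrite /hw; do 2!case: exc_pos => //; lia.
Qed.

(** The three cases in the height condition of [xi_rel] are the values 1, -1 and 0 of [i < m] -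
    val_i. *)
Lemma mirror_xi_rel n (W V : history n) (m : 'I_n) : mirror W V m -> xi_rel W V.
Proof.
move=> WV; have [cm c_gt valV hV cV] := WV; have [cm' c_gt' _ _ _] := mirror_sym WV.
have valm := exc_val_hc0 cm.
rewrite /xi_rel (cs_eq cm c_gt) (cs_eq cm' c_gt').
have mE : n.+1 - m.+1 = (rev_ord m).+1 by rewrite /=; have := ltn_ord m; lia.
split.
- by rewrite mE.
- move=> j; rewrite mE eqSS val_eqE => jm.
  rewrite step_low -/(exc_val _) -(rev_ordK j) valV rev_ordK negb_and !negbK.
  by rewrite -(inj_eq rev_ord_inj) rev_ordK in jm; rewrite (negbTE jm).
- move=> j; rewrite mE ltnS step_low -/(exc_val _) -(rev_ordK j).
  set i := rev_ord j; rewrite valV hV.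
  have -> : (rev_ord m < rev_ord i) = (i < m).
    by have := ltn_ord i; have := ltn_ord m; rewrite /=; lia.
  have -> : ((rev_ord i).+1 < (rev_ord m).+1) = (m < i).
    by have := ltn_ord i; have := ltn_ord m; rewrite /=; lia.
  rewrite !rev_ordK.
  case: eqVneq => [->|ne]; rewrite ?valm ?ltnn /=; first by lia.
  case: (ltngtP i m) => [h|h|/val_inj h]; last by rewrite h eqxx in ne.
    by case: exc_val => /=; lia.
  by case: exc_val => /=; lia.
by move=> j; rewrite -(rev_ordK j) cV hV rev_ordK; lia.
Qed.

Lemma xi_rel_mirror n (W V : history n) : 0 < n -> xi_rel W V ->
  exists m : 'I_n, mirror W V m.
Proof.
move=> n_gt0; have [m [csm cm c_gt]] := csP W n_gt0.
have [m' [csm' cm' _]] := csP V n_gt0.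
rewrite /xi_rel csm csm' subSS => -[mm' valV hV cV]; exists m.
have mE : m' = rev_ord m.
  by apply: val_inj; move: mm' => /=; have := ltn_ord m; lia.
have valm := exc_val_hc0 cm.
have valE i : exc_val (hw V (rev_ord i)) = (i != m) && ~~ exc_val (hw W i).
  have := valV (rev_ord i); rewrite step_low -/(exc_val _) -mm' mE rev_ordK eqSS.
  rewrite -/(exc_val _) val_eqE (inj_eq rev_ord_inj).
  (* At the position exempt from the step condition, the bit of [V] is 0 because its label is 0
     there. *)
  case: eqVneq => [->|_] /=; last by move/(_ isT) => <-; rewrite negbK.
  by rewrite -mE exc_val_hc0.
have hE i : (hh V (rev_ord i) = hh W i - (exc_val (hw W i))%:Z + (i < m)%N%:Z)%R.
  rewrite hV -mm' mE step_low -/(exc_val _) valE rev_ordK.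
  have -> : ((rev_ord m).+1 < (rev_ord i).+1) = (i < m).
    by have := ltn_ord i; have := ltn_ord m; rewrite /=; lia.
  have -> : ((rev_ord i).+1 < (rev_ord m).+1) = (m < i).
    by have := ltn_ord i; have := ltn_ord m; rewrite /=; lia.
  case: eqVneq => [->|ne]; rewrite ?valm ?ltnn /=; first by lia.
  case: (ltngtP i m) => [h|h|/val_inj h]; last by rewrite h eqxx in ne.
    by case: exc_val => /=; lia.
  by case: exc_val => /=; lia.
by split=> // i; rewrite cV hE rev_ordK; lia.
Qed.

(** * Construction of the mirrored history *)

Definition make_step (pos val : bool) : step :=
  if pos then if val then stepdE else stepN else if val then stepS else stepE.

Lemma exc_pos_make_step a b : exc_pos (make_step a b) = a.
Proof. by case: a; case: b. Qed.

Lemma exc_val_make_step a b : exc_val (make_step a b) = b.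
Proof. by case: a; case: b. Qed.

Lemma ord_pred_val n (i : 'I_n) : 0 < i -> ord_pred i = i.-1 :> nat.
Proof.
move=> i_gt0 /=; have lt_in := ltn_ord i.
by rewrite (_ : (i + n).-1 = i.-1 + n) ?modnDr ?modn_small //; lia.
Qed.

(** The final height is h + pos - val = 0 while val <= c <= h. *)
Lemma exc_pos_last n (W : history n) (i : 'I_n) : i.+1 = n -> exc_pos (hw W i) = false.
Proof.
move=> iE; have := hh_end W; rewrite -[X in height _ X = _]iE heightS -/(hh W i).
by have [] := hc_bounds W i; case: exc_pos => //; lia.
Qed.

Lemma exists_mirror n (W : history n) : 0 < n -> exists V m, @mirror n W V m.
Proof.
move=> n_gt0; have [m [_ cm c_gt]] := csP W n_gt0.
pose pos i := exc_pos (hw W i); pose val i := exc_val (hw W i).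
have c_bounds i : ((val i)%:Z <= hc W i)%R /\ (hc W i <= hh W i)%R := hc_bounds W i.
have valm : val m = false := exc_val_hc0 cm.
(* The position bits are those forced by the heights. The guard [0 < i] gives the last step position
   bit 0, and keeps the cyclic [ord_pred] from wrapping around. *)
pose w : {ffun 'I_n -> step} := [ffun j => let i := rev_ord j in
  make_step ((0 < i) && ~~ pos (ord_pred i)) ((i != m) && ~~ val i)].
pose H (i : 'I_n) : int := (hh W i - (val i)%:Z + (i < m)%N%:Z)%R.
pose c : {ffun 'I_n -> int} := [ffun j => let i := rev_ord j in
  (hc W i - (val i)%:Z + (i < m)%N%:Z)%R].
(* The path [w] has the prescribed heights [H]. The induction starts from the end of [W], where h -
   val = 0. *)
have heightw k (kn : k < n) : height w k = H (rev_ord (Ordinal kn)).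
  elim: k kn => [|k IH] kn.
    rewrite height0 /H; set i := rev_ord _.
    have iE : i.+1 = n by rewrite /=; lia.
    have -> : (i < m) = false by have := ltn_ord m; lia.
    have := hh_end W; rewrite -[X in height _ X = _]iE heightS -/(hh W i) exc_pos_last //.
    by rewrite -/(val i); lia.
  have kn' := ltnW kn; rewrite (heightS w (Ordinal kn')) (IH kn') ffunE.
  rewrite exc_pos_make_step exc_val_make_step.
  set i := rev_ord (Ordinal kn'); set i' := rev_ord (Ordinal kn).
  have iE : i = i'.+1 :> nat by rewrite /=; lia.
  have -> : ord_pred i = i' by apply: val_inj; rewrite [LHS]ord_pred_val iE.
  clearbody i i'.
  have hS : (hh W i = hh W i' + (pos i')%:Z - (val i')%:Z)%R by rewrite /hh iE heightS.
  have i_gt0 : 0 < i by rewrite iE.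
  rewrite /H hS i_gt0 /=; case: eqVneq => [im|ne].
    rewrite im valm ltnn (_ : i' < m) /=; last by rewrite -im iE.
    by case: (pos i'); lia.
  have ne' : i'.+1 != m by rewrite -iE.
  have -> : (i' < m) = (i < m) by rewrite iE; lia.
  by move: (pos i') (val i') (val i) => [] [] [] /=; lia.
(* The last step of [w] mirrors the first of [W], where h = val = 0: it descends from [0 < m] by the
   same amount. *)
have heightw_end : height w n = 0%R.
  pose o := Ordinal n_gt0; have oE : n = (rev_ord o).+1 by rewrite /=; lia.
  rewrite [X in height w X]oE heightS (heightw _ (ltn_ord _)) ffunE.
  rewrite (_ : Ordinal _ = rev_ord o); last exact: val_inj.
  have valo : val o = false.
    by have [] := c_bounds o; rewrite /hh height0; case: (val o); lia.
  rewrite exc_pos_make_step exc_val_make_step rev_ordK /H /hh height0 valo.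
  by rewrite -val_eqE /=; case: (nat_of_ord m).
have V_ok : laguerre (w, c).
  have Hge i : (0 <= H i)%R by have [] := c_bounds i; rewrite /H; lia.
  apply/andP; split; first (apply/andP; split; last by apply/eqP).
    apply/forallP=> -[k kn]; have := kn; rewrite ltnS leq_eqVlt /= => /predU1P[->|kn'].
      by rewrite heightw_end.
    by rewrite (heightw k kn').
  apply/forallP=> j; rewrite /= (heightw j (ltn_ord j)) step_low -/(exc_val _) !ffunE.
  rewrite exc_val_make_step (_ : Ordinal _ = j); last exact: val_inj.
  set i := rev_ord j; have [c_ge c_le] := c_bounds i; have := c_gt i.
  move=> cN; apply/andP; split; last by rewrite /H; lia.
  clearbody i; case: eqVneq => [->|ne] /=; first by rewrite cm valm ltnn.
  (* For i < m the new label is at least 1. For i > m the label c is nonzero, so c - val is at least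
     1 - val, the new value bit. *)
  case: (ltngtP i m) cN => [h _|h /(_ isT)|/val_inj h]; last by rewrite h eqxx in ne.
    by move: (val i) c_ge => [] /=; lia.
  by move: (val i) c_ge => [] /=; lia.
exists (exist _ (w, c) V_ok : history n), m; split=> // i.
- by rewrite /hw /= ffunE exc_val_make_step rev_ordK.
- rewrite /hh /hw /= (heightw _ (ltn_ord (rev_ord i))) -/(val i) -/(H i); congr H.
  by rewrite -[RHS]rev_ordK; congr rev_ord; apply: val_inj.
- by rewrite /hc /= ffunE rev_ordK.
Qed.

Lemma mirror_cs n (W V : history n) (m m' : 'I_n) :
  mirror W V m -> cs W = m'.+1 -> m = m'.
Proof. by case=> cm c_gt _ _ _; rewrite (cs_eq cm c_gt) => -[/val_inj]. Qed.

(** Each [W] has a mirror; choose one as [f W]. Then [W] and [f (f W)] are both mirrors of [f W] for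
    the same index, hence equal by [history_ext]. *)
Lemma xi_exists n : 0 < n -> exists f, @xi_spec n f.
Proof.
move=> n_gt0; have exV W : exists V, @xi_rel n W V.
  by have [V [m WV]] := exists_mirror W n_gt0; exists V; exact: mirror_xi_rel WV.
pose f W := proj1_sig (constructive_indefinite_description _ (exV W)).
have fP W : xi_rel W (f W) := proj2_sig (constructive_indefinite_description _ (exV W)).
exists f; split=> // W.
have [m WV] := xi_rel_mirror n_gt0 (fP W).
have [m' VU] := xi_rel_mirror n_gt0 (fP (f W)).
have VW := mirror_sym WV; have mm' : m' = rev_ord m.
  by case: VW => c0 cgt _ _ _; apply: mirror_cs VU _; apply: cs_eq.
rewrite {}mm' in VU; case: VU VW => _ _ valU hU cU [_ _ valW hW cW].
by apply: history_ext => i; rewrite -(rev_ordK i) ?valU ?valW ?hU ?hW ?cU ?cW.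
Qed.

Lemma xiP n : 0 < n -> xi_spec (@xi n).
Proof. by move=> n_gt0; apply: epsilon_spec; exact: xi_exists. Qed.

(** * Mirrored statistics *)

(** Compare the heights at a and b in both histories. If b is not m, its two value bits add up to 1;
    if b = m they are both 0, and the jump of [i < m] between a and b supplies the 1. *)
Lemma mirror_pos n (W V : history n) (m a b : 'I_n) : mirror W V m ->
  b = a.+1 :> nat -> exc_pos (hw V (rev_ord b)) = ~~ exc_pos (hw W a).
Proof.
move=> [cm _ valV hV _] bE; have valm := exc_val_hc0 cm.
have aE : rev_ord a = (rev_ord b).+1 :> nat by rewrite /= bE; have := ltn_ord b; lia.
have hVa : (hh V (rev_ord a) = hh V (rev_ord b) + (exc_pos (hw V (rev_ord b)))%:Z
            - (exc_val (hw V (rev_ord b)))%:Z)%R by rewrite /hh aE heightS.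
have hWb : (hh W b = hh W a + (exc_pos (hw W a))%:Z - (exc_val (hw W a))%:Z)%R.
  by rewrite /hh bE heightS.
move: hVa; rewrite !hV hWb valV; case: (eqVneq b m) => [bm|ne] /=.
  rewrite bm valm ltnn (_ : a < m) /=; last by rewrite -bm bE.
  by do 2!case: exc_pos => //=; lia.
have ne' : a.+1 != m by rewrite -bE.
have -> : (b < m) = (a < m) by rewrite bE; lia.
by move: (exc_val (hw W a)) (exc_val (hw W b)) => [] []; do 2!case: exc_pos => //=; lia.
Qed.

Lemma exc_val_hwFZ n (p : 'S_n) (v : 'I_n) : exc_val (hw (FZ p) v) = exced p ((p^-1)%g v).
Proof. by rewrite /hw ffunE exc_val_FZ /exced permKV. Qed.

Lemma exc_pos_hwFZ n (p : 'S_n) (i : 'I_n) : exc_pos (hw (FZ p) i) = exced p i.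
Proof. by rewrite /hw ffunE exc_pos_FZ. Qed.

Lemma hc_FZ n (p : 'S_n) (v : 'I_n) :
  hc (FZ p) v = ((side p ((p^-1)%g v))%:Z + (exc_val (hw (FZ p) v))%:Z)%R.
Proof. by rewrite /hc ffunE. Qed.

Lemma last_value_ord_max n (p : 'S_n.+1) : last_value p = (p ord_max).+1.
Proof. by rewrite /last_value enum_ordSr map_rcons last_rcons. Qed.

(* Seen from a nonexceedance to its left, the last letter counts in the side
   number whenever it is smaller. *)
Lemma cs_FZ n (p : 'S_n) : 0 < n -> cs (FZ p) = last_value p.
Proof.
case: n p => // n p _; rewrite last_value_ord_max.
have nexc_last : exced p ord_max = false by rewrite /exced ltnNge -ltnS ltn_ord.
apply: cs_eq => [|i lt_i].
  rewrite hc_FZ exc_val_hwFZ permK nexc_last /side nexc_last eq_card0 // => j.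
  by rewrite inE (_ : (@ord_max n < j) = false) ?andbF // ltnNge leq_ord.
rewrite hc_FZ exc_val_hwFZ; case nexc_i: (exced p ((p^-1)%g i)); first by lia.
rewrite /side nexc_i => /eqP; rewrite addr0 eqz_nat cards_eq0 => /eqP/setP/(_ ord_max).
rewrite !inE nexc_last permKV lt_i andbT ltn_neqAle leq_ord andbT val_eqE /=.
move/negbFE/eqP => iE.
by rewrite -iE permKV ltnn in lt_i.
Qed.

(** * Multisets of labels through their multiplicities *)

Local Open Scope mset_scope.

(* F v is the multiplicity of the label v.+1 of v : 'I_n. *)
Definition has_mult n (A : {mset nat}) (F : 'I_n -> nat) : Prop :=
  (forall v : 'I_n, A v.+1 = F v) /\ (forall x, (x == 0) || (n < x) -> A x = 0).

Section HasMult.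
Variable n : nat.
Implicit Types (A B : {mset nat}) (F G : 'I_n -> nat).

Lemma has_mult_eq A B F G : has_mult A F -> has_mult B G -> F =1 G -> A = B.
Proof.
move=> [AF A0] [BG B0] FG; apply/msetP=> x.
have [out|] := boolP ((x == 0) || (n < x)); first by rewrite A0 ?B0.
rewrite negb_or -leqNgt; case: x => //= x xn.
by rewrite (AF (Ordinal xn)) (BG (Ordinal xn)).
Qed.

Lemma has_multD A B F G : has_mult A F -> has_mult B G ->
  has_mult (A `+` B) (fun v => F v + G v).
Proof. by move=> [AF A0] [BG B0]; split=> x => [|out]; rewrite msetE2 ?AF ?BG ?A0 ?B0. Qed.

Lemma has_multB A B F G : has_mult A F -> has_mult B G ->
  has_mult (A `\` B) (fun v => F v - G v).
Proof. by move=> [AF A0] [BG B0]; split=> x => [|out]; rewrite msetE2 ?AF ?BG ?A0 ?B0. Qed.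

Lemma has_mult1 (m : 'I_n) : has_mult [mset m.+1] (fun v => v == m : nat).
Proof.
split=> x; first by rewrite msetnE eqSS val_eqE; case: eqP.
move=> out; rewrite msetnE; case: eqP => // xE.
by move: out; rewrite xE /= ltnS leqNgt ltn_ord.
Qed.

Lemma has_mult_kappa A F : has_mult A F -> has_mult (kappa n.+1 A) (fun v => F (rev_ord v)).
Proof.
(* All elements lie between 1 and n, where [n.+1 - s] is not truncated. *)
move=> [AF A0]; have A_in s : s \in (A : seq nat) -> 0 < s <= n.
  move=> sA; have := mset_gt0 s A; rewrite sA.
  have [out|] := boolP ((s == 0) || (n < s)); first by rewrite A0.
  by rewrite negb_or -leqNgt -lt0n.
split=> [v|x out]; rewrite mset_seqE count_map.
  rewrite -AF -count_mem_mset; apply: eq_in_count => s /A_in /=.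
  by have := ltn_ord v; lia.
rewrite (eq_in_count (a2 := pred0)) ?count_pred0 // => s /A_in /=.
by move: out; lia.
Qed.

Lemma has_mult_fset (A : {fset nat}) (P : pred 'I_n) :
    (forall v : 'I_n, (v.+1 \in A) = P v) ->
    (forall x, x \in A -> 0 < x <= n) ->
  has_mult A (fun v => P v : nat).
Proof.
move=> AP A_in; have AE x : (A : {mset nat}) x = (x \in A).
  by rewrite mset_seqE count_uniq_mem.
split=> [v|x out]; rewrite AE ?AP //; apply/eqP; rewrite eqb0.
by apply: contraL out => /A_in; lia.
Qed.

End HasMult.

Lemma has_mult_values n (p : 'S_n) (P : pred 'I_n) :
  has_mult [fset (p i).+1 | i : 'I_n & P i]%fset (fun v => P ((p^-1)%g v) : nat).
Proof.
apply: has_mult_fset => [v|x /imfsetP[i _ ->]]; last by rewrite ltn_ord.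
apply/imfsetP/idP => /= [[i Pi [/val_inj ->]]|Pv]; first by rewrite permK.
by exists ((p^-1)%g v); rewrite ?permKV.
Qed.

Lemma big_msetDE (I : finType) (P : pred I) (F : I -> {mset nat}) (x : nat) :
  (\big[msetD/mset0]_(i | P i) F i) x = \sum_(i | P i) F i x.
Proof.
by apply: (big_morph (fun A : {mset nat} => A x)) => [A B|]; rewrite ?msetE2 ?mset0E.
Qed.

Lemma has_mult_Ine n (p : 'S_n) : has_mult (Ine p) (fun v => side p ((p^-1)%g v)).
Proof.
split=> [v|x out]; rewrite big_msetDE.
  rewrite (bigD1 ((p^-1)%g v)) //= permKV msetnxx big1 ?addn0 // => i iv.
  rewrite msetnE eqSS val_eqE; case: eqP => // vE.
  by rewrite vE permK eqxx in iv.
rewrite big1 // => i _; rewrite msetnE; case: eqP => // xE.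
by move: out; rewrite xE /= ltnS leqNgt ltn_ord.
Qed.

(** The block of i contains the label of v exactly when i < v <= p i; by [height_FZ] the
    multiplicity is the height at v. *)
Lemma has_mult_Edif n (p : 'S_n) :
  has_mult (Edif p) (fun v : 'I_n => #|[set i : 'I_n | (i < v) && (v <= p i)]|).
Proof.
have E x : Edif p x = \sum_(i < n | exced p i) (i.+2 <= x < (p i).+2).
  rewrite big_msetDE; apply: eq_bigr => i _.
  by rewrite mset_seqE count_uniq_mem ?iota_uniq // mem_index_iota.
split=> [v|x out]; rewrite E.
  rewrite -big_mkcondr -sum1_card; apply: eq_bigl => i.
  by rewrite inE /exced !ltnS; lia.
rewrite big1 // => i _; apply/eqP; rewrite eqb0.
by move: out; have := ltn_ord (p i); lia.
Qed.

(** * Transfer of the statistics along the mirror relation *)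

Lemma mirror_last n (p : 'S_n) (V : history n) (m : 'I_n) :
  mirror (FZ p) V m -> last_value p = m.+1.
Proof. by case=> cm c_gt _ _ _; rewrite -cs_FZ ?(cs_eq cm) // (leq_ltn_trans _ (ltn_ord m)). Qed.

(** Value bits are complementary except at m, where both are 0; removing the last value of [q]
    accounts for that place. *)
Lemma mirror_Exc n (p q : 'S_n) (m : 'I_n) : mirror (FZ p) (FZ q) m ->
  (Exc p : {mset nat}) = kappa n.+1 (Nexc q `\ last_value q).
Proof.
move=> pq; rewrite (mirror_last (mirror_sym pq)); have [cm _ valq _ _] := pq.
apply: has_mult_eq (has_mult_values p (exced p))
  (has_mult_kappa (has_multB (has_mult_values q (fun i => ~~ exced q i)) (has_mult1 _))) _.
move=> v; rewrite -!exc_val_hwFZ valq (inj_eq rev_ord_inj).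
case: eqVneq => [->|_]; last by rewrite negbK subn0.
by rewrite (exc_val_hc0 cm).
Qed.

Lemma mirror_Nexc n (p q : 'S_n) (m : 'I_n) : mirror (FZ p) (FZ q) m ->
  Nexc p `\ last_value p = kappa n.+1 (Exc q).
Proof.
move=> pq; rewrite (mirror_last pq); have [_ _ valq _ _] := pq.
apply: has_mult_eq (has_multB (has_mult_values p (fun i => ~~ exced p i)) (has_mult1 _))
  (has_mult_kappa (has_mult_values q (exced q))) _.
move=> v; rewrite -!exc_val_hwFZ valq.
by case: eqVneq => _; case: exc_val.
Qed.

Lemma mirror_Ine n (p q : 'S_n) (m : 'I_n) : mirror (FZ p) (FZ q) m ->
  (Ine p `+` Excb p) `\` Nexca p = kappa n.+1 (Ine q)
  /\ Ine q = kappa n.+1 ((Ine p `+` Excb p) `\` Nexca p).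
Proof.
move=> pq; have lp := mirror_last pq; have [cm c_gt valq _ cq] := pq.
have valm := exc_val_hc0 cm.
have multp := has_multB (has_multD (has_mult_Ine p)
    (has_mult_values p (fun i => exced p i && ((p i).+1 < last_value p))))
  (has_mult_values p (fun i => ~~ exced p i && (last_value p < (p i).+1))).
(* Both sides equal c - val + [v < m] - val'. For v > m the label c is nonzero, so subtracting the
   [Nexca] term is not truncated. *)
have sideE v : side p ((p^-1)%g v)
      + (exced p ((p^-1)%g v) && ((p ((p^-1)%g v)).+1 < last_value p))
      - (~~ exced p ((p^-1)%g v) && (last_value p < (p ((p^-1)%g v)).+1))
    = side q ((q^-1)%g (rev_ord v)).
  rewrite permKV lp !ltnS -!exc_val_hwFZ; have := cq v; have := c_gt v.
  rewrite !hc_FZ valq; case: eqVneq => [->|ne] /=; rewrite ?valm ?ltnn /=; first by lia.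
  case: (ltngtP v m) => [h _|h /(_ isT)|/val_inj h]; last by rewrite h eqxx in ne.
    by case: exc_val => /=; lia.
  by case: exc_val => /=; lia.
split; first exact: has_mult_eq multp (has_mult_kappa (has_mult_Ine q)) sideE.
apply: has_mult_eq (has_mult_Ine q) (has_mult_kappa multp) _ => v.
by rewrite sideE rev_ordK.
Qed.

(** The multiplicity is h - c, nonnegative by the label bounds, and mirroring shifts h and c
    equally. *)
Lemma mirror_Edif n (p q : 'S_n) (m : 'I_n) : mirror (FZ p) (FZ q) m ->
  (Edif p `\` Exc p) `\` Ine p = kappa n.+1 ((Edif q `\` Exc q) `\` Ine q).
Proof.
move=> pq; have [_ _ _ hq cq] := pq.
have mult (r : 'S_n) := has_multB (has_multB (has_mult_Edif r)
  (has_mult_values r (exced r))) (has_mult_Ine r).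
apply: has_mult_eq (mult p) (has_mult_kappa (mult q)) _ => v.
have diffE (r : 'S_n) (u : 'I_n) : Posz (#|[set i : 'I_n | (i < u) && (u <= r i)]|
      - exced r ((r^-1)%g u) - side r ((r^-1)%g u)) = (hh (FZ r) u - hc (FZ r) u)%R.
  have [_] := hc_bounds (FZ r) u.
  rewrite hc_FZ exc_val_hwFZ /hh height_FZ.
  by move: (side r _) (nat_of_bool _) #|_| => a b c; lia.
by apply/eqP; rewrite -eqz_nat !diffE hq cq; lia.
Qed.

(** [mirror_pos] relates a position a to the mirror image of a + 1, hence the reflection in n
    instead of n + 1. The last position is never an exceedance, so both sides live in [n - 1]. *)
Lemma mirror_Ep n (p q : 'S_n) (m : 'I_n) : mirror (FZ p) (FZ q) m ->
  interval1 n.-1 `\` Ep p = kappa n (Ep q).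
Proof.
case: n p q m => [|n] p q m pq; first by have := ltn_ord m.
have mult (r : 'S_n.+1) : has_mult (Ep r) (fun i : 'I_n => exced r (widen_ord (leqnSn n) i)).
  apply: has_mult_fset => [v|x /imfsetP[i /= ei ->]].
    apply/imfsetP/idP => /= [[i ei [vi]]|ev].
      by rewrite (_ : widen_ord _ v = i) //; apply: val_inj.
    by exists (widen_ord (leqnSn n) v).
  by have := ltn_ord (r i); rewrite /exced unfold_in /= in ei *; lia.
have mult1 : has_mult (interval1 n) (fun _ : 'I_n => true).
  by apply: has_mult_fset => [v|x]; rewrite !inE mem_iota add1n !ltnS ?ltn_ord.
apply: has_mult_eq (has_multB mult1 (mult p)) (has_mult_kappa (mult q)) _ => v /=.
have := mirror_pos (b := lift ord0 v) pq (_ : _ = (widen_ord (leqnSn n) v).+1).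
rewrite !exc_pos_hwFZ => /(_ erefl).
rewrite (_ : rev_ord (lift ord0 v) = widen_ord (leqnSn n) (rev_ord v)).
  by move=> ->; case: exced.
by apply: val_inj => /=; have := ltn_ord v; rewrite /bump /=; lia.
Qed.

Theorem corollary4p12 (n : nat) (n_gt0 : 0 < n) (p : 'S_n) :
  let q := eta p in
  [/\ (Exc p : {mset nat}) = kappa n.+1 (Nexc q `\ last_value q),
      Nexc p `\ last_value p = kappa n.+1 (Exc q),
      (Ine p `+` Excb p) `\` Nexca p = kappa n.+1 (Ine q)
    & [/\ Ine p = kappa n.+1 ((Ine q `+` Excb q) `\` Nexca q),
          (Edif p `\` Exc p) `\` Ine p
            = kappa n.+1 ((Edif q `\` Exc q) `\` Ine q)
        & interval1 n.-1 `\` Ep p = kappa n (Ep q)]].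
Proof.
move=> q; have [_ /(_ (FZ p))/(xi_rel_mirror n_gt0)[m]] := xiP n_gt0.
(* Surjectivity of [FZ] excludes the default value in [FZ_inv]. *)
have <- : FZ q = xi (FZ p).
  rewrite /q /eta /FZ_inv; have [r rE] := FZ_surj (xi (FZ p)).
  by case: pickP => [s /eqP //|/(_ r)]; rewrite rE eqxx.
(* The formula for [Ine p] comes from the mirror relation with [p] and [q] exchanged. *)
move=> pq; have [Inep _] := mirror_Ine pq; have [_ Ineq] := mirror_Ine (mirror_sym pq).
split; [exact: mirror_Exc pq|exact: mirror_Nexc pq|exact: Inep|].
by split; [exact: Ineq|exact: mirror_Edif pq|exact: mirror_Ep pq].
Qed.
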